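(* Let $(\mathfrak{g},\langle\cdot,\cdot\rangle)$ be a pseudo-Riemannian Lie algebra in the class $\mathcal{W}_0$. If its $U$-tensor is associative, i.e. $U(U(X,Y),Z)=U(X,U(Y,Z))$ for all $X,Y,Z\in\mathfrak{g}$, then the product $X\divideontimes Y:=U(X,Y)$ endows $\mathfrak{g}$ with the structure of a nilpotent commutative associative algebra.
   Context: A pseudo-Riemannian Lie algebra $(\mathfrak{g},\langle\cdot,\cdot\rangle)$ is a finite-dimensional real Lie algebra $\mathfrak{g}$ with a nondegenerate symmetric bilinear form $\langle\cdot,\cdot\rangle$ (of arbitrary signature). Its $U$-tensor is the symmetric bilinear map $U:\mathfrak{g}\times\mathfrak{g}\to\mathfrak{g}$ determined by $$2\langle U(X,Y),Z\rangle=\langle[Z,X],Y\rangle+\langle[Z,Y],X\rangle\qquad\text{for all }X,Y,Z\in\mathfrak{g};$$ it is the symmetric part of the Levi-Civita connection $\nabla_XY=\frac12[X,Y]+U(X,Y)$. Put $\theta(X,Y,Z)=\langle U(X,Y),Z\rangle$. The pair $(\mathfrak{g},\langle\cdot,\cdot\rangle)$ belongs to the class $\mathcal{W}_0$ if the metric contraction of $\theta$ in its first two arguments vanishes: $\sum_{i,j}g^{ij}\theta(e_i,e_j,Z)=0$ for all $Z\in\mathfrak{g}$, where $\{e_i\}$ is any basis of $\mathfrak{g}$ and $(g^{ij})$ is the inverse of the matrix $(\langle e_i,e_j\rangle)$. An associative algebra is nilpotent if there is an $N\in\mathbb{N}$ such that every product of $N$ elements is zero. *)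

(* Defs.v *)
From mathcomp Require Import all_boot all_order all_algebra.
From mathcomp Require Import classical_sets reals.

Set Implicit Arguments.
Unset Strict Implicit.
Unset Printing Implicit Defensive.

Import Order.TTheory GRing.Theory Num.Theory.
Local Open Scope ring_scope.

Section PseudoRiemannianLieAlgebra.

Variables (R : realType) (V : vectType R).

Record is_lie_bracket (br : {bilinear V -> V -> V}) : Prop := IsLieBracket {
  lie_alternating : forall X, br X X = 0;
  lie_jacobi : forall X Y Z,
    br X (br Y Z) + br Y (br Z X) + br Z (br X Y) = 0 }.

Record is_pseudo_riemannian_lie_algebra
    (br : {bilinear V -> V -> V}) (g : {symmetric V}) : Prop :=
  IsPseudoRiemannianLieAlgebra {
    prla_bracket : is_lie_bracket br;
    prla_nondegenerate : nondegenerate g }.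

(* U(X,Y) is the vector W with 2<W,Z> = <[Z,X],Y> + <[Z,Y],X> for all Z; the
   default value 0 is never used when g is nondegenerate (see [UtensorP]). *)
Definition Utensor (br : {bilinear V -> V -> V}) (g : {symmetric V})
    (X Y : V) : V :=
  xget 0 [set W | forall Z, 2 * g W Z = g (br Z X) Y + g (br Z Y) X]%classic.

Definition theta_tensor (br : {bilinear V -> V -> V}) (g : {symmetric V})
    (X Y Z : V) : R := g (Utensor br g X Y) Z.

Definition gram (g : {symmetric V}) n (e : n.-tuple V) : 'M[R]_n :=
  \matrix_(i, j) g e`_i e`_j.

(* The quantification over all bases is harmless: by [class_W0_basis] one basis
   suffices; and the Gram matrix is invertible by [gram_unit]. *)
Definition class_W0 (br : {bilinear V -> V -> V}) (g : {symmetric V}) : Prop :=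
  forall n (e : n.-tuple V), basis_of fullv e ->
  forall Z, \sum_i \sum_j
    invmx (gram g e) i j * theta_tensor br g e`_i e`_j Z = 0.

(* The left-bracketed product x * s_1 * ... * s_N has N + 1 factors, so this
   ranges over all positive lengths; for an associative product the bracketing
   is immaterial. *)
Definition nilpotent_product (op : V -> V -> V) : Prop :=
  exists N, forall (x : V) (s : N.-tuple V), foldl op x s = 0.

Record is_nilpotent_comm_assoc_algebra (op : V -> V -> V) : Prop :=
  IsNilpotentCommAssocAlgebra {
    nca_bilinear : bilinear_for *:%R *:%R op;
    nca_commutative : commutative op;
    nca_associative : associative op;
    nca_nilpotent : nilpotent_product op }.

Lemma nondegenerate_eq0 (g : {symmetric V}) (W : V) :
  nondegenerate g -> (forall Z, g W Z = 0) -> W = 0.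
Proof.
move=> /eqP gnd gW0; apply/eqP; rewrite -memv0 -gnd.
by apply/mem_orthovP => Z _; exact: gW0.
Qed.

Lemma gramC (g : {symmetric V}) X Y : g X Y = g Y X.
Proof. by rewrite hermC /= expr0 mul1r. Qed.

Lemma gram_unit (g : {symmetric V}) n (e : n.-tuple V) :
  nondegenerate g -> basis_of fullv e -> gram g e \in unitmx.
Proof.
move=> gnd be; rewrite -row_free_unit -kermx_eq0; apply/rowV0P => v.
move=> /sub_kermxP vG0.
have W0 : \sum_i v 0 i *: e`_i = 0.
  apply: (nondegenerate_eq0 gnd) => Z.
  rewrite (coord_basis be (memvf Z)) linear_sumr big1 // => j _.
  rewrite linearZr_LR /= linear_sumlz.
  move/matrixP/(_ 0 j): vG0; rewrite !mxE => vG0.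
  rewrite (_ : \sum_i _ = 0) ?mulr0 // -[RHS]vG0.
  by apply: eq_bigr => i _; rewrite linearZl_LR /= mxE.
have /freeP fe := basis_free be.
by apply/rowP => i; rewrite mxE; exact: (fe (fun i => v 0 i)).
Qed.

Lemma Utensor_unique (g : {symmetric V}) (W W' : V) :
  nondegenerate g -> (forall Z, 2 * g W Z = 2 * g W' Z) -> W = W'.
Proof.
move=> gnd WW'; apply/eqP; rewrite -subr_eq0; apply/eqP.
apply: (nondegenerate_eq0 gnd) => Z; rewrite linearBl /=; apply/eqP.
rewrite subr_eq0; apply/eqP.
by apply: (@mulfI _ 2); rewrite ?pnatr_eq0 ?WW'.
Qed.

Lemma UtensorP (br : {bilinear V -> V -> V}) (g : {symmetric V}) X Y Z :
  nondegenerate g ->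
  2 * g (Utensor br g X Y) Z = g (br Z X) Y + g (br Z Y) X.
Proof.
move=> gnd; move: Z.
apply: (@xgetPex _ 0 [set W | forall Z, 2 * g W Z = _]%classic).
pose e := vbasis {:V}; have be : basis_of fullv e by exact: vbasisP.
have Gu := gram_unit gnd be.
pose c : 'rV_(\dim {:V}) :=
  \row_j (2^-1 * (g (br e`_j X) Y + g (br e`_j Y) X)).
have [w wG] : exists w, w *m gram g e = c.
  by exists (c *m invmx (gram g e)); rewrite mulmxKV.
exists (\sum_i w 0 i *: e`_i) => Z.
set W := \sum_i _.
have WE (j : 'I_(\dim {:V})) : 2 * g W e`_j = g (br e`_j X) Y + g (br e`_j Y) X.
  have -> : g W e`_j = c 0 j.
    rewrite -wG mxE linear_sumlz.
    by apply: eq_bigr => i _; rewrite linearZl_LR /= mxE.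
  by rewrite mxE mulVKf ?pnatr_eq0.
rewrite (coord_basis be (memvf Z)) linear_sumr mulr_sumr.
rewrite !(linear_sumlz br) !(linear_sumlz g) -big_split /=.
apply: eq_bigr => j _.
by rewrite (linearZr_LR g) !(linearZl_LR br) !(linearZl_LR g) /= mulrCA WE mulrDr.
Qed.

Lemma class_W0_basis (br : {bilinear V -> V -> V}) (g : {symmetric V})
    n (e : n.-tuple V) :
  nondegenerate g -> basis_of fullv e ->
  (forall Z, \sum_i \sum_j
    invmx (gram g e) i j * theta_tensor br g e`_i e`_j Z = 0) ->
  class_W0 br g.
Proof.
move=> gnd be He m f bf Z.
have nm : n = m by rewrite -(size_basis be) (size_basis bf).
subst m; have {He} := He Z.
have Ge := gram_unit gnd be; have Gf := gram_unit gnd bf.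
pose B X Y := theta_tensor br g X Y Z.
have BE X Y : B X Y = 2^-1 * (g (br Z X) Y + g (br Z Y) X).
  by rewrite -(UtensorP br X Y Z gnd) mulKf ?pnatr_eq0.
have BC X Y : B X Y = B Y X by rewrite !BE addrC.
have Bl (a : 'I_n -> R) Y :
    B (\sum_k a k *: e`_k) Y = \sum_k a k * B e`_k Y.
  rewrite BE linear_sumr /= linear_sumlz linear_sumr -big_split /= mulr_sumr.
  apply: eq_bigr => k _.
  by rewrite BE !linearZr_LR /= linearZl_LR /= -mulrDr mulrCA.
pose M (h : n.-tuple V) : 'M[R]_n := \matrix_(i, j) B h`_i h`_j.
have [P fE] : exists P : 'M[R]_n, forall i : 'I_n, f`_i = \sum_j P i j *: e`_j.
  exists (\matrix_(i, j) coord e j f`_i) => i.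
  rewrite {1}(coord_basis be (memvf f`_i)).
  by apply: eq_bigr => j _; rewrite mxE.
have trE (h : n.-tuple V) : \sum_i \sum_j invmx (gram g h) i j *
    theta_tensor br g h`_i h`_j Z = \tr (invmx (gram g h) *m M h).
  apply: eq_bigr => i _; rewrite mxE; apply: eq_bigr => j _.
  by rewrite [M h j i]mxE BC.
have gPE : gram g f = P *m gram g e *m P^T.
  apply/matrixP => i j; rewrite -mulmxA !mxE !fE linear_sumlz.
  apply: eq_bigr => k _; rewrite linearZl_LR /= mxE linear_sumr.
  congr (_ * _); apply: eq_bigr => l _.
  by rewrite linearZr_LR /= !mxE mulrC.
have MPE : M f = P *m M e *m P^T.
  apply/matrixP => i j; rewrite -mulmxA !mxE (fE i) Bl.
  apply: eq_bigr => k _; rewrite mxE BC (fE j) Bl; congr (_ * _).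
  by apply: eq_bigr => l _; rewrite !mxE BC mulrC.
have Pu : P \in unitmx.
  by move: Gf; rewrite gPE !unitmx_mul => /andP[/andP[]].
rewrite !trE gPE MPE => He.
have PtG : invmx (P *m gram g e *m P^T)
    = invmx P^T *m invmx (gram g e) *m invmx P.
  have GPu : P *m gram g e *m P^T \in unitmx.
    by rewrite !unitmx_mul unitmx_tr Pu Ge.
  apply: (can_inj (mulKmx GPu)).
  rewrite mulmxV ?unitmx_mul ?unitmx_tr ?Pu ?Ge //.
  by rewrite !mulmxA mulmxK ?unitmx_tr // mulmxK // mulmxV.
rewrite PtG !mulmxA mulmxKV // mxtrace_mulC !mulmxA mulmxV ?unitmx_tr //.
by rewrite mul1mx.
Qed.

End PseudoRiemannianLieAlgebra.

(* Main.v *)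
From HB Require Import structures.
Require Import Defs.
From mathcomp Require Import all_boot all_order all_algebra.
From mathcomp Require Import reals.

Import GRing.Theory Num.Theory.
Local Open Scope ring_scope.

(** Evaluating the cyclic identity
    <XY, Z> + <YZ, X> + <ZX, Y> = 0 at X = Y = e with ee = e gives
    <e, Z> = - 2 <eZ, e> for all Z; substituting eZ for Z yields <eZ, e> = 0,
    so e = 0 by nondegeneracy.  A finite-dimensional commutative associative
    algebra A without nonzero idempotents is nilpotent: by a Fitting argument
    every multiplication operator is nilpotent, and then a Nakayama argument
    kills the stable term of the descending chain A, A^2, A^3, ... *)

(** The iterates from [fullv] form a descending chain, and each strict step costs a dimension, so
    index [(\dim {:V}).+1] cannot be reached by strict steps only. *)
Lemma iter_fullv_stable {F : fieldType} {V : vectType F}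
    {f : {vspace V} -> {vspace V}} :
  (forall W W', (W <= W')%VS -> (f W <= f W')%VS) ->
  exists n, f (iter n f fullv) = iter n f fullv.
Proof.
move=> fS.
have anti n : (iter n.+1 f fullv <= iter n f fullv)%VS.
  by elim: n => [|n IHn]; [exact: subvf | exact: fS].
have stable_or_drop n : (exists m, f (iter m f fullv) = iter m f fullv) \/
    (\dim (iter n f fullv) + n <= \dim {:V})%N.
  elim: n => [|n [|IHn]]; [by right; rewrite addn0 | by left |].
  have [/eqP|neq] := boolP (iter n.+1 f fullv == iter n f fullv).
    by left; exists n.
  right; apply: leq_trans IHn; rewrite addnS -addSn leq_add2r.
  by move: neq; rewrite eqEdim anti -ltnNge.
case: (stable_or_drop (\dim {:V}).+1) => // /(leq_trans (leq_addl _ _)).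
by rewrite ltnn.
Qed.

Section NoIdempotent.

Context {F : fieldType} {V : vectType F} {op : {bilinear V -> V -> V}}.
Hypotheses (opC : commutative op) (opA : associative op).
Hypothesis idem0 : forall e, op e e = e -> e = 0.

Let L x : 'End(V) := linfun (op x).

Lemma mult_op_nilpotent x : exists n, forall v, iter n (op x) v = 0.
Proof.
have [n Wstable] := iter_fullv_stable (limgS (L x)).
set W := iter n _ fullv in Wstable.
have iterW v : iter n (op x) v \in W.
  rewrite /W; elim: n {W Wstable} => [|n IHn] /=; first exact: memvf.
  by rewrite -[op x _](lfunE (op x)); exact: memv_img.
have divW k w : w \in W -> exists2 w', w' \in W & w = iter k (op x) w'.
  elim: k w => [|k IHk] w Ww; first by exists w.
  have /memv_imgP[u /IHk[w' Ww' ->] ->] : w \in (L x @: W)%VS.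
    by rewrite Wstable.
  by exists w' => //=; rewrite lfunE.
(* [y] is the power of [x] with exponent [n.+1]: it lies in the stable image [W] and, since [op x]
   maps [W] onto itself, so does [op y]. *)
pose y := iter n (op x) x.
have opyE w : op y w = iter n.+1 (op x) w.
  rewrite iterSr /y; elim: (n) => //= m IHm.
  by rewrite -opA IHm.
have divy w : w \in W -> exists2 w', w' \in W & w = op y w'.
  by move/(divW n.+1)=> [w' Ww' ->]; exists w' => //; rewrite opyE.
(* With y = ye and e = yz, commutativity gives ee = z(ye) = zy = e, so [e] is idempotent. *)
have [e We ye] := divy y (iterW x).
have [z _ ez] := divy e We.
have e0 : e = 0.
  by apply: idem0; rewrite {1}ez (opC y) -opA -ye opC -ez.
have y0 : y = 0 by rewrite ye e0 linear0r.
by exists n => v; have [w' _ ->] := divy _ (iterW v); rewrite y0 linear0l.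
Qed.

(** Generators are discarded one at a time. Iterating [W <= a W + J], where [J] is stable under [a],
    puts [W] inside [a^k V + J] for every [k], and [a^k] eventually acts as zero. *)
Lemma nakayama (W : {vspace V}) (s : seq V) :
  (forall x, (L x @: W <= W)%VS) -> (W <= \sum_(x <- s) L x @: W)%VS ->
  W = 0%VS.
Proof.
move=> WI; elim: s => [|a s IHs]; first by rewrite big_nil subv0 => /eqP.
rewrite big_cons; set J := (\sum_(x <- s) _)%VS in IHs * => WJ; apply: IHs.
have LaJ : (L a @: J <= J)%VS.
  rewrite /J limg_sum; elim: (s) => [|b t IHt].
    by rewrite !big_nil subvv.
  rewrite !big_cons; apply: addvS IHt; rewrite -limg_comp.
  have -> : (L a \o L b = L b \o L a)%VF.
    by apply/lfunP => v; rewrite !comp_lfunE !lfunE /= !opA (opC a).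
  by rewrite limg_comp limgS.
have WkJ k w : w \in W -> exists u, exists2 j, j \in J & w = iter k (op a) u + j.
  elim: k w => [|k IHk] w Ww; first by exists w, 0; rewrite ?mem0v ?addr0.
  have /memv_addP[_ /memv_imgP[w1 Ww1 ->] [j1 Jj1 ->]] := subvP WJ _ Ww.
  have [u [j2 Jj2 ->]] := IHk _ Ww1.
  exists u, (L a j2 + j1); last by rewrite linearD /= lfunE addrA.
  by apply: memvD => //; apply: (subvP LaJ); exact: memv_img.
have [n an0] := mult_op_nilpotent a.
by apply/subvP => w /(WkJ n)[u [j Jj ->]]; rewrite an0 add0r.
Qed.

Lemma nilpotent_of_no_idempotent :
  exists N, forall (x : V) (s : N.-tuple V), foldl op x s = 0.
Proof.
pose b := vbasis {:V}.
(* This is the span of all products A W; basis vectors suffice as left factors, which leaves a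
   finite sum fit for [nakayama]. *)
pose mulA (W : {vspace V}) : {vspace V} := (\sum_(x <- b) L x @: W)%VS.
have opW x w (W : {vspace V}) : w \in W -> op x w \in mulA W.
  move=> Ww; rewrite (coord_vbasis (memvf x)) linear_sumlz /mulA big_tuple.
  apply: memv_sumr => i _; rewrite linearZl_LR /= memvZ //.
  by rewrite -(tnth_nth 0) -[op _ _](lfunE (op _)) memv_img.
have mulAS W W' : (W <= W')%VS -> (mulA W <= mulA W')%VS.
  move=> sWW'; rewrite /mulA; elim: (tval b) => [|a s IHs].
    by rewrite !big_nil subvv.
  by rewrite !big_cons addvS ?limgS.
have [n Wstable] := iter_fullv_stable mulAS.
have W0 : iter n mulA fullv = 0%VS.
  apply: (nakayama _ b); last by rewrite -[X in (X <= _)%VS]Wstable subvv.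
  move=> x; apply/subvP => _ /memv_imgP[w Ww ->].
  by rewrite lfunE -Wstable; exact: opW.
(* The [n]-th iterate is the power of A with exponent [n.+1], matching the [n.+1] factors [x] and
   [s]. *)
exists n => x s; apply/eqP; rewrite -memv0 -W0 -[n in iter n](size_tuple s).
elim/last_ind: {s}(tval s) => [|s y IHs]; first exact: memvf.
by rewrite foldl_rcons size_rcons opC; exact: opW.
Qed.

End NoIdempotent.

Section Utensor.

Context {R : realType} {V : vectType R}.
Context (br : {bilinear V -> V -> V}) {g : {symmetric V}}.
Hypothesis gnd : nondegenerate g.

Local Notation U := (Utensor br g).

Lemma UtensorC : commutative U.
Proof.
move=> X Y; apply: (Utensor_unique gnd) => Z.
by rewrite !UtensorP // addrC.
Qed.

Lemma Utensor_bilinear : bilinear_for *:%R *:%R U.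
Proof.
have Ul Y : GRing.linear_for *:%R (U^~ Y).
  move=> a X X'; apply: (Utensor_unique gnd) => Z.
  rewrite linearDl linearZl_LR /= mulrDr mulrCA !UtensorP //.
  rewrite !linearDr !linearZr_LR /= linearDl linearZl_LR /=.
  by rewrite mulrDr addrACA.
split=> // X a Y Y'; rewrite !(UtensorC X); exact: Ul.
Qed.

(** After doubling, the six bracket terms cancel in pairs by antisymmetry. *)
Lemma Utensor_cyclic X Y Z : is_lie_bracket br ->
  g (U X Y) Z + g (U Y Z) X + g (U Z X) Y = 0.
Proof.
move=> [brXX _].
have brC A B : br A B = - br B A.
  apply/eqP; rewrite -addr_eq0; move: (brXX (A + B)).
  by rewrite linearDl !linearDr /= !brXX add0r addr0 => ->.
apply: (@mulfI _ 2); first by rewrite pnatr_eq0.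
rewrite !mulrDr !UtensorP // mulr0 (brC X Y) (brC Y Z) (brC Z X).
rewrite !linearNl /=.
by rewrite (addrC (- g (br X Z) Y + _)) !addrA !addrK addNr.
Qed.

End Utensor.

Theorem proposition4p4 (R : realType) (V : vectType R)
    (br : {bilinear V -> V -> V}) (g : {symmetric V})
    (hg : is_pseudo_riemannian_lie_algebra br g)
    (hW0 : class_W0 br g)
    (hassoc : forall X Y Z : V,
      Utensor br g (Utensor br g X Y) Z = Utensor br g X (Utensor br g Y Z)) :
  is_nilpotent_comm_assoc_algebra (Utensor br g).
Proof.
case: hg => lie_br gnd.
have UC := UtensorC br gnd.
have Ubil := Utensor_bilinear br gnd.
have UA : associative (Utensor br g) by move=> X Y Z; rewrite hassoc.
split=> //.
pose Ub : {bilinear V -> V -> V} :=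
  HB.pack (Utensor br g) (bilinear_isBilinear.Build R V V V *:%R *:%R _ Ubil).
apply: (nilpotent_of_no_idempotent (op := Ub) UC UA) => e /= ee.
have cyc Z : g e Z + 2 * g (Utensor br g e Z) e = 0.
  have := Utensor_cyclic br gnd e e Z lie_br.
  by rewrite ee (UC Z) -addrA -mulr2n mulr_natl.
(* Since e(eZ) = (ee)Z = eZ, the identity [cyc] at eZ reads 3<eZ, e> = 0. *)
have eZe0 Z : g (Utensor br g e Z) e = 0.
  have := cyc (Utensor br g e Z); rewrite -hassoc ee gramC => /eqP.
  by rewrite mulr_natl -mulrS mulrn_eq0 /= => /eqP.
by apply: (nondegenerate_eq0 gnd) => Z; rewrite -[RHS](cyc Z) eZe0 mulr0 addr0.
Qed.
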